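(* Let $\lambda$ be a Borel measure on $\mathbb{R}^d$ and let $K \in \mathcal{K}$ be a non-degenerated transition kernel. Then $K$ is $\lambda$-symmetric if and only if for every Borel measurable function $f:\mathbb{R}^d\times\mathbb{R}^d\to\mathbb{R}$ that is quasi-integrable with respect to $\lambda\otimes K$ it holds that $$\int_{\mathbb{R}^d}\int_{\mathbb{R}^d} f(x,y)\,K(x,\mathrm{d}y)\,\mathrm{d}\lambda(x)=\int_{\mathbb{R}^d}\int_{\mathbb{R}^d} f(x,y)\,K(y,\mathrm{d}x)\,\mathrm{d}\lambda(y).$$
   Context: $\mathcal{B}(\mathbb{R}^d)$ is the Borel $\sigma$-algebra. A transition kernel is a map $K:\mathbb{R}^d\times\mathcal{B}(\mathbb{R}^d)\to[0,\infty]$ such that $K(x,\cdot)$ is a $\sigma$-finite measure for every $x\in\mathbb{R}^d$ and $K(\cdot,A)$ is Borel measurable for every $A\in\mathcal{B}(\mathbb{R}^d)$. It is non-degenerated if $x\mapsto\int_{\mathbb{R}^d} f(x,y)\,K(x,\mathrm{d}y)$ is Borel measurable for every non-negative Borel measurable $f:\mathbb{R}^d\times\mathbb{R}^d\to\mathbb{R}$; $\mathcal{K}$ denotes the set of non-degenerated transition kernels. For a Borel measure $\lambda$ on $\mathbb{R}^d$ and $K\in\mathcal{K}$, two measures on $\mathbb{R}^d\times\mathbb{R}^d$ are defined by $$(\lambda\otimes K)(M)=\int_{\mathbb{R}^d}\int_{\mathbb{R}^d}\chi_M(x,y)\,K(x,\mathrm{d}y)\,\mathrm{d}\lambda(x),\qquad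 (K\otimes\lambda)(M)=\int_{\mathbb{R}^d}\int_{\mathbb{R}^d}\chi_M(x,y)\,K(y,\mathrm{d}x)\,\mathrm{d}\lambda(y).$$ $K$ is called $\lambda$-symmetric if $\lambda\otimes K=K\otimes\lambda$. A function is quasi-integrable with respect to a measure if the integral of its positive part or the integral of its negative part is finite. Inner integrals only need to be defined for $\lambda$-a.e. value of the outer variable. *)

(* Defs.v *)
From HB Require Import structures.
From mathcomp Require Import all_boot all_order all_algebra.
From mathcomp Require Import all_classical all_reals all_analysis.
From mathcomp Require Import measurable_realfun kernel.
Import Order.TTheory GRing.Theory Num.Theory.
Import numFieldNormedType.Exports.

Set Implicit Arguments.
Unset Strict Implicit.
Unset Printing Implicit Defensive.

Local Open Scope classical_set_scope.
Local Open Scope ring_scope.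
Local Open Scope ereal_scope.

(* R^d and R^d x R^d with their Borel sigma-algebras; Rd2 R d carries the
   Borel sets of the product topology, and its elements are pairs (x, y). *)
Definition Rd (R : realType) (d : nat) :=
  g_sigma_algebraType (@open 'rV[R]_d).

Definition Rd2 (R : realType) (d : nat) :=
  g_sigma_algebraType (@open ('rV[R]_d * 'rV[R]_d)%type).

(* R.-sigmafker T ~> T only asks each K x to be sigma-finite, without
   uniformity in x. *)
Definition nondegenerate (R : realType) (d : nat)
    (K : R.-sigmafker (Rd R d) ~> (Rd R d)) : Prop :=
  forall f : Rd2 R d -> R, measurable_fun setT f -> (forall z, (0 <= f z)%R) ->
    measurable_fun setT (fun x : Rd R d => \int[K x]_y (f (x, y))%:E).

Record ndkernel (R : realType) (d : nat) := NdKernel {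
  ndkernel_kernel :> R.-sigmafker (Rd R d) ~> (Rd R d) ;
  ndkernelP : nondegenerate ndkernel_kernel }.

Lemma continuous_pairl (S T : topologicalType) (x : S) :
  continuous (fun y : T => (x, y)).
Proof. by move=> y; apply: cvg_pair; [exact: cvg_cst|exact: cvg_id]. Qed.

Lemma continuous_pairr (S T : topologicalType) (y : T) :
  continuous (fun x : S => (x, y)).
Proof. by move=> x; apply: cvg_pair; [exact: cvg_id|exact: cvg_cst]. Qed.

Lemma continuous_swap (S T : topologicalType) :
  continuous (fun z : S * T => (z.2, z.1)).
Proof. by move=> z; apply: cvg_pair; [exact: cvg_snd|exact: cvg_fst]. Qed.

Section products.
Context (R : realType) (d : nat).
Variables (lam : {measure set (Rd R d) -> \bar R}) (K : ndkernel R d).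

(* lam (x) K and K (x) lam: in both, M lives on pairs (x, y), but lam governs x
   in the first and y in the second. *)
Definition tensor_mk (M : set (Rd2 R d)) : \bar R :=
  \int[lam]_x \int[K x]_y (\1_M ((x, y) : Rd2 R d))%:E.

Definition tensor_km (M : set (Rd2 R d)) : \bar R :=
  \int[lam]_y \int[K y]_x (\1_M ((x, y) : Rd2 R d))%:E.

Lemma measurable_g_sigma (S T : pointedType) (G : set (set S))
    (H : set (set T)) (f : S -> T) :
  (forall B, H B -> G (f @^-1` B)) ->
  measurable_fun setT (f : g_sigma_algebraType G -> g_sigma_algebraType H).
Proof.
move=> GH.
apply: (@measurability _ _ (g_sigma_algebraType G) (g_sigma_algebraType H)
  setT f H) => //.
by move=> _ [B HB <-]; apply: sub_sigma_algebra; rewrite setTI; exact: GH.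
Qed.

Lemma measurable_pairl (x : Rd R d) :
  measurable_fun setT (fun y : Rd R d => (x, y) : Rd2 R d).
Proof. by apply: measurable_g_sigma; apply/continuousP; exact: continuous_pairl. Qed.

Lemma measurable_pairr (y : Rd R d) :
  measurable_fun setT (fun x : Rd R d => (x, y) : Rd2 R d).
Proof. by apply: measurable_g_sigma; apply/continuousP; exact: continuous_pairr. Qed.

Lemma measurable_swapd :
  measurable_fun setT (fun z : Rd2 R d => (z.2, z.1) : Rd2 R d).
Proof. by apply: measurable_g_sigma; apply/continuousP; exact: continuous_swap. Qed.

Section sigma_additivity.
Variable p : Rd R d -> Rd R d -> Rd2 R d.
Hypothesis mp : forall x, measurable_fun setT (p x).
Hypothesis mKp : forall M, measurable M ->
  measurable_fun setT (fun x => \int[K x]_y (\1_M (p x y))%:E).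

Lemma iterated_indic_sigma_additive : semi_sigma_additive
  (fun M : set (Rd2 R d) => \int[lam]_x \int[K x]_y (\1_M (p x y))%:E).
Proof.
move=> F mF tF mUF.
have ge0 n x : 0 <= \int[K x]_y (\1_(F n) (p x y))%:E.
  by apply: integral_ge0 => y _; rewrite lee_fin.
rewrite [X in _ --> X](_ : _ =
    \sum_(n <oo) \int[lam]_x \int[K x]_y (\1_(F n) (p x y))%:E).
  by apply: is_cvg_nneseries => n _ _; exact: integral_ge0.
rewrite -integral_nneseries//; last by move=> n; exact: mKp.
apply: eq_integral => x _.
rewrite -integral_nneseries//; last first.
  move=> n; apply/measurable_EFinP.
  exact: measurableT_comp (measurable_indic (mF n)) (mp x).
by apply: eq_integral => y _; rewrite indic_bigcup.
Qed.

End sigma_additivity.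

Let mk0 : tensor_mk set0 = 0.
Proof.
rewrite /tensor_mk integral0_eq// => x _.
by rewrite integral0_eq// => y _; rewrite indic0.
Qed.

Let mk_ge0 M : 0 <= tensor_mk M.
Proof.
by apply: integral_ge0 => x _; apply: integral_ge0 => y _; rewrite lee_fin.
Qed.

Let mk_sigma_additive : semi_sigma_additive tensor_mk.
Proof.
apply: (@iterated_indic_sigma_additive (fun x y => (x, y))).
  exact: measurable_pairl.
by move=> M mM; apply: ndkernelP => //; exact: measurable_indic.
Qed.

HB.instance Definition _ := isMeasure.Build _ (Rd2 R d) R tensor_mk
  mk0 mk_ge0 mk_sigma_additive.

Let km0 : tensor_km set0 = 0.
Proof.
rewrite /tensor_km integral0_eq// => x _.
by rewrite integral0_eq// => y _; rewrite indic0.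
Qed.

Let km_ge0 M : 0 <= tensor_km M.
Proof.
by apply: integral_ge0 => x _; apply: integral_ge0 => y _; rewrite lee_fin.
Qed.

Let km_sigma_additive : semi_sigma_additive tensor_km.
Proof.
apply: (@iterated_indic_sigma_additive (fun y x => (x, y))).
  exact: measurable_pairr.
move=> M mM.
apply: (ndkernelP K (f := fun z => \1_M ((z.2, z.1) : Rd2 R d))) => //.
exact: measurableT_comp (measurable_indic mM) measurable_swapd.
Qed.

HB.instance Definition _ := isMeasure.Build _ (Rd2 R d) R tensor_km
  km0 km_ge0 km_sigma_additive.

End products.

(* Set functions are only constrained on measurable sets, so equality of
   measures is equality there. *)
Definition kernel_symmetric (R : realType) (d : nat)
    (lam : {measure set (Rd R d) -> \bar R}) (K : ndkernel R d) : Prop :=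
  forall M : set (Rd2 R d), measurable M -> tensor_mk lam K M = tensor_km lam K M.

Definition quasi_integrable (disp : measure_display) (T : measurableType disp)
    (R : realType) (mu : {measure set T -> \bar R}) (f : T -> \bar R) : Prop :=
  measurable_fun setT f /\
  (\int[mu]_x f^\+ x < +oo \/ \int[mu]_x f^\- x < +oo).

(* The iterated integral of g (outer variable first) is well defined.  The
   library integral is total, with +oo - +oo = -oo, so definedness is stated
   separately; at the negligible set of x where the inner integral does not
   exist, the total inner integral is used, and its value is irrelevant. *)
Definition iterated_integrable (R : realType) (d : nat)
    (lam : {measure set (Rd R d) -> \bar R})
    (K : ndkernel R d) (g : Rd R d -> Rd R d -> R) : Prop :=
  {ae lam, forall x, quasi_integrable (K x) (fun y => (g x y)%:E)} /\
  quasi_integrable lam (fun x => \int[K x]_y (g x y)%:E).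

(* Main.v *)
Require Import Defs.
From HB Require Import structures.
From mathcomp Require Import all_boot all_order all_algebra.
From mathcomp Require Import all_classical all_reals all_analysis.
From mathcomp Require Import measurable_realfun kernel.
From mathcomp Require Import lra.
Import Order.TTheory GRing.Theory Num.Theory.
Import numFieldNormedType.Exports.

Local Open Scope classical_set_scope.
Local Open Scope ring_scope.
Local Open Scope ereal_scope.

(** Both iterated integrals are integrals against a mixture of measures.  Let
    [nu x] be the image of [K x] under [y |-> (x, y)], or under [y |-> (y, x)]
    for the second order of integration.  Then [tensor_mk lam K], respectively
    [tensor_km lam K], is the mixture [M |-> \int[lam]_x nu x M].

    For any mixture [mu], the integral against [mu] of a nonnegative function
    is the integral of its integrals against the [nu x]: this holds for simple
    functions by linearity and passes to increasing limits
    ([ge0_integral_mixture]).  For a quasi-integrable [f], apply this to the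
    positive and the negative part: one of the two functions
    [x |-> \int[nu x]_z f^\+ z] and [x |-> \int[nu x]_z f^\- z] has a finite
    integral, hence is finite almost everywhere, so the inner integral of [f]
    exists almost everywhere, and its outer integral exists and equals
    [\int[mu]_z f z] ([quasi_integrable_mixture]).

    If [K] is symmetric, the single measure [tensor_mk lam K] is a mixture in
    both ways, so both iterated integrals of [f] exist and equal its integral
    against that measure ([iterated_integral], used once for each order).
    Conversely, indicator functions are nonnegative, hence quasi-integrable,
    and for the indicator of [M] the equality of the iterated integrals is the
    equality of the two measures at [M]. *)

(** * Integral of a difference of nonnegative extended-real functions *)

Section ereal_difference.
Context (dX : measure_display) (X : measurableType dX) (R : realType).
Variable lam : {measure set X -> \bar R}.
Variables A B : X -> \bar R.
Hypotheses (mA : measurable_fun setT A) (mB : measurable_fun setT B).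
Hypotheses (A0 : forall x, 0 <= A x) (B0 : forall x, 0 <= B x).

Local Notation F := (fun x => A x - B x).

Let mF : measurable_fun setT F.
Proof. exact: emeasurable_funB. Qed.

Lemma le_integral_funepos_sub : \int[lam]_x F^\+ x <= \int[lam]_x A x.
Proof.
apply: ge0_le_integral => //; first exact: measurable_funepos.
move=> x _; rewrite funeposE ge_max A0 andbT.
by rewrite -[leRHS]adde0 leeD2l// leeNl oppe0.
Qed.

Lemma le_integral_funeneg_sub : \int[lam]_x F^\- x <= \int[lam]_x B x.
Proof.
apply: ge0_le_integral => //; first exact: measurable_funeneg.
move=> x _; rewrite funenegE ge_max B0 andbT.
by rewrite leeNl -[leLHS]add0e leeD2r.
Qed.

(** This rearrangement of [F^\+ - F^\- = A - B] has no subtraction left, so it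
    can be integrated term by term.  It survives the points where both [A] and
    [B] are infinite: there [F] is [-oo], and both sides are [+oo]. *)
Lemma funeposneg_cross x : F^\+ x + B x = A x + F^\- x.
Proof.
rewrite funeposE funenegE; move: (A0 x) (B0 x).
case: (A x) => [a| |//]; case: (B x) => [b| |//] _ _ /=.
(* The three infinite cases hold by computation; only finite [a], [b] remain. *)
all: rewrite /maxe /= ?ltey ?ltNye//=.
rewrite -EFinB !lte_fin oppr_lt0 subr_gt0 subr_lt0.
by case: ltgtP => [?|?|->]; rewrite -!EFinD; congr EFin; lra.
Qed.

(** Only one of the two integrals has to be finite, unlike in linearity for
    integrable functions: the integral of [F] is then allowed to be infinite.
    Integrating [funeposneg_cross] gives
    [\int F^\+ + \int B = \int A + \int F^\-]; the bounds
    [\int F^\+ <= \int A] and [\int F^\- <= \int B] leave the infinite values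
    no freedom, so the terms can be moved across. *)
Lemma integral_sub_ge0 :
  \int[lam]_x A x < +oo \/ \int[lam]_x B x < +oo ->
  \int[lam]_x F x = \int[lam]_x A x - \int[lam]_x B x.
Proof.
have : \int[lam]_x F^\+ x + \int[lam]_x B x =
       \int[lam]_x A x + \int[lam]_x F^\- x.
  rewrite -!ge0_integralD//.
  - by apply: eq_integral => x _; exact: funeposneg_cross.
  - exact: measurable_funeneg.
  - exact: measurable_funepos.
rewrite [in X in _ -> _ -> X]integralE.
have := le_integral_funepos_sub; have := le_integral_funeneg_sub.
have : 0 <= \int[lam]_x F^\+ x by exact: integral_ge0.
have : 0 <= \int[lam]_x F^\- x by exact: integral_ge0.
have : 0 <= \int[lam]_x A x by exact: integral_ge0.
have : 0 <= \int[lam]_x B x by exact: integral_ge0.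
move: (\int[lam]_x F^\+ x) (\int[lam]_x F^\- x) (\int[lam]_x A x)
  (\int[lam]_x B x).
move=> [p| |] [n| |] [a| |] [b| |] //= _ _ _ _ _ _.
(* Evaluation leaves the case of four finite values, and goals in which the
   integrals of [A] and [B] are both infinite. *)
all: try by move=> _ [].
by move=> [pbE] _; rewrite -!EFinD; congr EFin; lra.
Qed.

End ereal_difference.

(** * Integration against a mixture of measures *)

Section mixture.
Context (dX dZ : measure_display) (X : measurableType dX)
  (Z : measurableType dZ) (R : realType).
Variables (lam : {measure set X -> \bar R}) (nu : X -> {measure set Z -> \bar R})
  (mu : {measure set Z -> \bar R}).
Hypothesis mnu : forall M, measurable M -> measurable_fun setT (nu ^~ M).
Hypothesis muE : forall M, measurable M -> mu M = \int[lam]_x nu x M.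

Import HBNNSimple.

Lemma sintegral_mixture (h : {nnsfun Z >-> R}) :
  sintegral mu h = \int[lam]_x sintegral (nu x) h.
Proof.
under eq_integral do rewrite sintegralE.
rewrite ge0_integral_fsum//; last 2 first.
  by move=> r; apply: measurable_funeM; exact: mnu.
  by move=> r x _; exact: nnsfun_mulemu_ge0.
rewrite sintegralE; apply: eq_fsbigr => r /set_mem[z _ <-].
rewrite muE// ge0_integralZl//; first exact: mnu.
by rewrite lee_fin.
Qed.

(** Monotone convergence is used three times along one approximation of [f] by
    simple functions: for [mu], for each [nu x], and for [lam], the last one
    because [x |-> sintegral (nu x) (g n)] increases with [n]. *)
Lemma ge0_integral_mixture (f : Z -> \bar R) :
  measurable_fun setT f -> (forall z, 0 <= f z) ->
  \int[mu]_z f z = \int[lam]_x \int[nu x]_z f z.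
Proof.
move=> mf f0.
pose g := nnsfun_approx measurableT mf.
have mg n : measurable_fun setT (EFin \o g n) by exact/measurable_EFinP.
have g_ge0 n z : 0 <= (g n z)%:E by rewrite lee_fin.
have nd_g z : {homo (fun n => (g n z)%:E) : n m / (n <= m)%O >-> n <= m}.
  by move=> n m nm; rewrite lee_fin; exact/lefP/nd_nnsfun_approx.
have intg (m : {measure set Z -> \bar R}) :
    \int[m]_z f z = limn (fun n => sintegral m (g n)).
  under [in RHS]eq_fun do rewrite -integralT_nnsfun.
  rewrite -monotone_convergence//; apply: eq_integral => z _.
  by apply/esym/cvg_lim => //; exact: cvg_nnsfun_approx.
rewrite intg; under [RHS]eq_integral do rewrite intg.
under [in LHS]eq_fun do rewrite sintegral_mixture.
rewrite -monotone_convergence//.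
- move=> n; under eq_fun do rewrite -integralT_nnsfun.
  exact: (measurable_fun_integral_kernel mnu (g_ge0 n) (mg n)).
- by move=> n x _; exact: sintegral_ge0.
- move=> x _ n m nm; rewrite -!integralT_nnsfun.
  by apply: ge0_le_integral => //; [exact: mg|exact: mg|move=> z _; exact: nd_g].
Qed.

(** The part of [f] with finite integral has a finite inner integral for almost
    every [x] only, which is why the first conclusion is an almost-everywhere
    one.  No null set is needed in the other two: the inner integral is
    [A x - B x] for every [x], with the convention [+oo - +oo = -oo]. *)
Lemma quasi_integrable_mixture (f : Z -> \bar R) :
  quasi_integrable mu f ->
  [/\ {ae lam, forall x, quasi_integrable (nu x) f},
      quasi_integrable lam (fun x => \int[nu x]_z f z) &
      \int[lam]_x \int[nu x]_z f z = \int[mu]_z f z].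
Proof.
move=> [mf fint].
pose A x := \int[nu x]_z f^\+ z; pose B x := \int[nu x]_z f^\- z.
have mfp := measurable_funepos mf; have mfn := measurable_funeneg mf.
have mA : measurable_fun setT A by apply: (measurable_fun_integral_kernel mnu).
have mB : measurable_fun setT B by apply: (measurable_fun_integral_kernel mnu).
have A0 x : 0 <= A x by exact: integral_ge0.
have B0 x : 0 <= B x by exact: integral_ge0.
have intf : (fun x => \int[nu x]_z f z) = (fun x => A x - B x).
  by apply/funext => x; rewrite integralE.
have fpE : \int[mu]_z f^\+ z = \int[lam]_x A x.
  by rewrite ge0_integral_mixture.
have fnE : \int[mu]_z f^\- z = \int[lam]_x B x.
  by rewrite ge0_integral_mixture.
rewrite fpE fnE in fint.
have ae_lty (C : X -> \bar R) : measurable_fun setT C -> (forall x, 0 <= C x) ->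
    \int[lam]_x C x < +oo -> {ae lam, forall x, C x < +oo}.
  move=> mC C0 Coo.
  have /(integrable_ae measurableT) : lam.-integrable setT C.
    apply/integrableP; split => //.
    by under eq_integral do rewrite gee0_abs//.
  by apply: filterS => x /(_ I); rewrite ge0_fin_numE.
split.
- case: fint => [/(ae_lty _ mA A0)|/(ae_lty _ mB B0)]; apply: filterS => x ?.
    by split => //; left.
  by split => //; right.
- rewrite intf; split; first exact: emeasurable_funB.
  case: fint => fint; [left|right].
    by apply: le_lt_trans fint; exact: le_integral_funepos_sub.
  by apply: le_lt_trans fint; exact: le_integral_funeneg_sub.
- by rewrite intf integral_sub_ge0// [RHS]integralE fpE fnE.
Qed.

End mixture.

(** * Image measures and quasi-integrability *)

Section pushforward.
Context (dY dZ : measure_display) (Y : measurableType dY)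
  (Z : measurableType dZ) (R : realType).
Variables (phi : Y -> Z) (mphi : measurable_fun setT phi).
Variable m : {measure set Y -> \bar R}.

Definition image_measure : {measure set Z -> \bar R}.
Proof. by unshelve refine (pushforward m phi : {measure set Z -> \bar R}). Defined.

Lemma ge0_integral_image_measure (f : Z -> \bar R) :
  measurable_fun setT f -> (forall z, 0 <= f z) ->
  \int[image_measure]_z f z = \int[m]_y f (phi y).
Proof. by move=> mf f0; rewrite (ge0_integral_pushforward mphi). Qed.

Lemma integral_image_measure (f : Z -> \bar R) : measurable_fun setT f ->
  \int[image_measure]_z f z = \int[m]_y f (phi y).
Proof.
move=> mf; rewrite integralE [RHS]integralE !ge0_integral_image_measure//.
- by rewrite -!/((_ \o phi) _) (funepos_comp f phi) (funeneg_comp f phi).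
- exact: measurable_funeneg.
- exact: measurable_funepos.
Qed.

Lemma quasi_integrable_image_measure (f : Z -> \bar R) :
  quasi_integrable image_measure f ->
  quasi_integrable m (fun y => f (phi y)).
Proof.
move=> [mf fint]; split; first exact: measurableT_comp mf mphi.
rewrite (funepos_comp f phi) (funeneg_comp f phi).
by case: fint; rewrite ge0_integral_image_measure//; [left|
  exact: measurable_funepos|right|exact: measurable_funeneg].
Qed.

End pushforward.
Arguments image_measure {dY dZ Y Z R phi} mphi m.

(** * Iterated integrals along a kernel *)

Section iterated.
Context (R : realType) (d : nat).
Variables (lam : {measure set (Rd R d) -> \bar R}) (K : ndkernel R d).
Variable p : Rd R d -> Rd R d -> Rd2 R d.
Hypothesis mp : forall x, measurable_fun setT (p x).
Hypothesis mKp : forall M, measurable M ->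
  measurable_fun setT (fun x => \int[K x]_y (\1_M (p x y))%:E).
Variable mu : {measure set (Rd2 R d) -> \bar R}.
Hypothesis muE : forall M, measurable M ->
  mu M = \int[lam]_x \int[K x]_y (\1_M (p x y))%:E.

(** The map [p] places the outer variable [x] and the inner variable [y] in
    the pair, which treats both orders of integration at once.  The measure
    [mu] is only known through its values on measurable sets, so under the
    symmetry hypothesis the same [mu] serves for both choices of [p]. *)
Lemma iterated_integral (f : Rd2 R d -> R) :
  measurable_fun setT f -> quasi_integrable mu (fun z => (f z)%:E) ->
  iterated_integrable lam K (fun x y => f (p x y)) /\
  \int[lam]_x \int[K x]_y (f (p x y))%:E = \int[mu]_z (f z)%:E.
Proof.
move=> mf qf.
have mEf : measurable_fun setT (fun z => (f z)%:E) by exact/measurable_EFinP.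
pose nu x := image_measure (mp x) (K x).
have nuE M x : measurable M -> nu x M = \int[K x]_y (\1_M (p x y))%:E.
  move=> mM; transitivity (\int[nu x]_z (\1_M z)%:E).
    by rewrite integral_indic// setIT.
  by rewrite integral_image_measure//; exact/measurable_EFinP.
have mnu M : measurable M -> measurable_fun setT (nu ^~ M).
  by move=> mM; under eq_fun do rewrite nuE//; exact: mKp.
have mu_nu M : measurable M -> mu M = \int[lam]_x nu x M.
  by move=> mM; rewrite muE//; apply: eq_integral => x _; rewrite nuE.
have [qnu qint <-] := quasi_integrable_mixture _ _ _ _ _ lam nu mu mnu mu_nu _ qf.
have intE : (fun x => \int[nu x]_z (f z)%:E) =
    (fun x => \int[K x]_y (f (p x y))%:E).
  by apply/funext => x; rewrite integral_image_measure.
rewrite intE in qint *; do 2 split => //.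
by apply: filterS qnu => x /quasi_integrable_image_measure.
Qed.

End iterated.

Theorem lemma2p5 (R : realType) (d : nat)
    (lam : {measure set (Rd R d) -> \bar R}) (K : ndkernel R d) :
  kernel_symmetric lam K <->
  (forall f : Rd2 R d -> R,
     measurable_fun setT f ->
     quasi_integrable (tensor_mk lam K) (fun z => (f z)%:E) ->
     [/\ iterated_integrable lam K (fun x y => f (x, y)),
         iterated_integrable lam K (fun y x => f (x, y)) &
         \int[lam]_x \int[K x]_y (f (x, y))%:E =
         \int[lam]_y \int[K y]_x (f (x, y))%:E]).
Proof.
split=> [symK f mf qf|symf M mM].
- have [|itl intl] := @iterated_integral R d lam K (fun x y => (x, y))
      (@measurable_pairl R d) _ (tensor_mk lam K) (fun _ _ => erefl) f mf qf.
    by move=> M mM; apply: ndkernelP => //; exact: measurable_indic.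
  have [|itr intr] := @iterated_integral R d lam K (fun y x => (x, y))
      (@measurable_pairr R d) _ (tensor_mk lam K) symK f mf qf.
    move=> M mM.
    apply: (ndkernelP K (f := fun z => \1_M ((z.2, z.1) : Rd2 R d))) => //.
    exact: measurableT_comp (measurable_indic mM) (@measurable_swapd R d).
  by split=> //; rewrite intl intr.
- have [] := symf \1_M => //; split; first exact/measurable_EFinP.
  right; rewrite integral0_eq ?ltry// => z _.
  by rewrite funenegE; apply/max_idPr; rewrite leeNl oppe0 lee_fin.
Qed.
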